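(* Let $f:\subseteq X\rightrightarrows\mathbb{N}$ and $g:\subseteq Z\rightrightarrows\mathbb{N}$ be partial multi-valued functions on represented spaces. If $f$ is slim and $\mathrm{U}f$ is a strong fractal, then $f\le_W g$ implies $|\mathrm{range}(f)|\le|\mathrm{range}(g)|$.
   Context: A representation of a set $X$ is a surjective partial function $\delta:\subseteq\mathbb{N}^\mathbb{N}\to X$; $\mathbb{N}$ is represented by $p\mapsto p(0)$. For $f:\subseteq(X,\delta_X)\rightrightarrows(Y,\delta_Y)$ a realizer is a single-valued partial $F$ on Baire space with $\delta_Y(F(p))\in f(\delta_X(p))$ for all $p\in\mathrm{dom}(f\circ\delta_X)$ ($F\vdash f$). With $\langle p,q\rangle(2n)=p(n)$, $\langle p,q\rangle(2n+1)=q(n)$: $f\le_W g$ iff there are computable partial $H,K$ on Baire space such that $p\mapsto H\langle p,G(K(p))\rangle$ realizes $f$ for every $G\vdash g$; $f\le_{sW}g$ iff there are computable $H,K$ with $H\circ G\circ K\vdash f$ for every $G\vdash g$. $\mathrm{range}(f)=\bigcup_{x\in\mathrm{dom}(f)}f(x)$. $f$ is slim if for every $y\in\mathrm{range}(f)$ there is $x\in\mathrm{dom}(f)$ with $f(x)=\{y\}$. $\mathrm{U}f$ is the restriction of $f$ to $\{x\in\mathrm{dom}(f):f(x)$ is a singleton$\}$. For $f:\subseteq(X,\delta_X)\rightrightarrows Y$ and $A\subseteq\mathbb{N}^\mathbb{N}$, $f_A$ is the restriction of $f$ to the represented space $(\delta_X(A),\delta_X|_A)$. $f$ is a strong fractal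 if $f\le_{sW}f_A$ for every $A\subseteq\mathbb{N}^\mathbb{N}$ that is non-empty and clopen in (the subspace topology of) $\mathrm{dom}(f\circ\delta_X)$. *)

(* Defs.v *)
From mathcomp Require Import all_boot.
From mathcomp Require Import boolp classical_sets functions cardinality.
From mathcomp Require Import topology.

Set Implicit Arguments.
Unset Strict Implicit.
Unset Printing Implicit Defensive.

Local Open Scope classical_set_scope.

(* [nat] is discrete, so this is Baire space with its usual topology. *)
Definition baire := prod_topology (fun _ : nat => nat).

Definition baire_pair (p q : baire) : baire :=
  fun n => if odd n then q n./2 else p n./2.

(* Single-valued partial functions, given by their graphs. *)
Record pfun (A B : Type) := PFun {
  pgraph :> A -> B -> Prop;
  pgraph_fun : forall a b b', pgraph a b -> pgraph a b' -> b = b' }.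

Lemma pcomp_fun A B C (G : pfun B C) (F : pfun A B) a c c' :
  (exists2 b, F a b & G b c) -> (exists2 b, F a b & G b c') -> c = c'.
Proof.
move=> [b Fb Gc] [b' Fb' Gc']; move: Gc'.
by rewrite (pgraph_fun Fb' Fb); exact: pgraph_fun.
Qed.

Definition pcomp A B C (G : pfun B C) (F : pfun A B) : pfun A C :=
  PFun (@pcomp_fun A B C G F).

Lemma pgraph_pair_fun (F : pfun baire baire) p r r' :
  (exists2 q, F p q & r = baire_pair p q) ->
  (exists2 q, F p q & r' = baire_pair p q) -> r = r'.
Proof. by move=> [q Fq ->] [q' Fq' ->]; rewrite (pgraph_fun Fq Fq'). Qed.

(* [p |-> <p, F p>] *)
Definition pgraph_pair (F : pfun baire baire) : pfun baire baire :=
  PFun (@pgraph_pair_fun F).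

(* Mu-recursive functions with an oracle. *)
Inductive oprog : nat -> Type :=
| OZero n : oprog n
| OSucc : oprog 1
| OProj n (i : 'I_n) : oprog n
| OOracle : oprog 1
| OComp m n (e : oprog m) (es : 'I_m -> oprog n) : oprog n
| ORec n (e0 : oprog n) (eS : oprog n.+2) : oprog n.+1
| OMu n (e : oprog n.+1) : oprog n.

(* [oeval p e v y]: with oracle [p], program [e] halts on input [v] with
   output [y].  [ORec] recurses on the first argument, with [eS] taking the
   recursion index, the previous value and the remaining arguments; [OMu]
   searches over the first argument of [e]. *)
Fixpoint oeval (p : baire) n (e : oprog n) : n.-tuple nat -> nat -> Prop :=
  match e in oprog n return n.-tuple nat -> nat -> Prop with
  | OZero n => fun _ y => y = 0
  | OSucc => fun v y => y = (thead v).+1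
  | OProj n i => fun v y => y = tnth v i
  | OOracle => fun v y => y = p (thead v)
  | OComp m n e es => fun v y =>
      exists2 w : m.-tuple nat,
        (forall i, oeval p (es i) v (tnth w i)) & oeval p e w y
  | ORec n e0 eS => fun v y =>
      let fix rec k : nat -> Prop :=
        match k with
        | 0 => oeval p e0 (behead_tuple v)
        | k'.+1 => fun z => exists2 u, rec k' u &
            oeval p eS (cons_tuple k' (cons_tuple u (behead_tuple v))) z
        end in
      rec (thead v) y
  | OMu n e => fun v y =>
      oeval p e (cons_tuple y v) 0 /\
      forall z, z < y -> exists u, oeval p e (cons_tuple z v) u.+1
  end.

(* The program has to be correct on the domain of [F] only, so restrictions of
   computable functions are computable. *)
Definition computable (F : pfun baire baire) :=
  exists e : oprog 1, forall p q, F p q ->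
    forall n, oeval p e [tuple n] (q n).

Record repSpace := RepSpace {
  carrier :> Type;
  rep : pfun baire carrier;
  rep_surj : forall x, exists p, rep p x }.

Lemma nat_rep_fun (p : baire) (m n : nat) : p 0 = m -> p 0 = n -> m = n.
Proof. by move=> <-. Qed.

Lemma nat_rep_surj (n : nat) : exists p : baire, p 0 = n.
Proof. by exists (fun=> n). Qed.

Definition natRep : repSpace :=
  @RepSpace nat (PFun nat_rep_fun) nat_rep_surj.

(* A partial multi-valued function is undefined at [x] iff [f x] is empty. *)
Definition mvfun (X Y : repSpace) := X -> set Y.

Section MultiValued.
Variables X Y : repSpace.
Implicit Type f : mvfun X Y.

Definition mdom f : set X := [set x | f x !=set0].

Definition mrange f : set Y := \bigcup_(x in mdom f) f x.

Definition namedom f : set baire := [set p | exists2 x, rep X p x & mdom f x].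

Definition slim f := forall y, mrange f y -> exists2 x, mdom f x & f x = [set y].

Definition mrestrict f (D : set X) : mvfun X Y := fun x => [set y | D x /\ f x y].

Definition Upart f : mvfun X Y :=
  mrestrict f [set x | mdom f x /\ exists y, f x = [set y]].

End MultiValued.

Section Subspace.
Variables (X : repSpace) (A : set baire).

Definition sub_carrier := {x : X | exists2 p, A p & rep X p x}.

Definition sub_graph (p : baire) (x : sub_carrier) := A p /\ rep X p (sval x).

Lemma sub_rep_fun p x y : sub_graph p x -> sub_graph p y -> x = y.
Proof. by move=> [_ px] [_ py]; apply/eq_sig_hprop/(pgraph_fun px py) => *; exact: Prop_irrelevance. Qed.

Lemma sub_rep_surj (x : sub_carrier) : exists p, sub_graph p x.
Proof. by case: x => x [p Ap px]; exists p. Qed.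

Definition subRep : repSpace :=
  @RepSpace sub_carrier (PFun sub_rep_fun) sub_rep_surj.

End Subspace.

Definition name_restrict (X Y : repSpace) (f : mvfun X Y) (A : set baire) :
  mvfun (subRep X A) Y := fun x => f (sval x).
Arguments name_restrict {X Y} f A.

Definition realizes (X Y : repSpace) (F : pfun baire baire)
    (f : mvfun X Y) :=
  forall p x, rep X p x -> mdom f x ->
    exists q, F p q /\ exists2 y, rep Y q y & f x y.

Definition weihrauch_le (X Y Z W : repSpace) (f : mvfun X Y) (g : mvfun Z W) :=
  exists H K : pfun baire baire, [/\ computable H, computable K &
    forall G : pfun baire baire, realizes G g ->
      realizes (pcomp H (pgraph_pair (pcomp G K))) f].

Definition strong_weihrauch_le (X Y Z W : repSpace)
    (f : mvfun X Y) (g : mvfun Z W) :=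
  exists H K : pfun baire baire, [/\ computable H, computable K &
    forall G : pfun baire baire, realizes G g ->
      realizes (pcomp H (pcomp G K)) f].

Definition strong_fractal (X Y : repSpace) (f : mvfun X Y) :=
  forall A : set baire, A !=set0 -> A `<=` namedom f ->
    clopen (A : set (subspace (namedom f))) ->
    strong_weihrauch_le f (name_restrict f A).

(* Main.v *)
Require Import Defs.
From mathcomp Require Import all_boot.
From mathcomp Require Import boolp classical_sets functions cardinality.
From mathcomp Require Import topology.

Set Implicit Arguments.
Unset Strict Implicit.
Unset Printing Implicit Defensive.

Local Open Scope classical_set_scope.

(* Feed [g] with a realizer that answers only with the names [n 0 0 ...],
   [n] in the range of [g].  If [p] names a point with a singleton value [y]
   and the answer for it is [n], then [H <p, n 0 0 ...>] has first digit [y],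
   and by finite use it has that digit for all names in a neighbourhood of [p].
   The fractal property and slimness ensure that [U f] still takes at least
   [|range f|] values on that clopen set, so as long as fewer answers [n] have
   been frozen to a constant digit, there is a name in it with yet another
   value, which forces a new answer.  Hence, unless [|range f| <= |range g|],
   the range of [g] contains arbitrarily many numbers. *)

Definition agree (N : nat) (p q : baire) := forall i, i < N -> p i = q i.

Lemma agree_leq M N p q : M <= N -> agree N p q -> agree M p q.
Proof. by move=> MN pq i iM; apply: pq; exact: leq_trans MN. Qed.

Lemma agree_baire_pair N p p' q : agree N p p' ->
  agree N (baire_pair p q) (baire_pair p' q).
Proof.
move=> pp' i iN; rewrite /baire_pair; case: ifP => // _; apply: pp'.
by apply: leq_ltn_trans iN; rewrite -{2}(odd_double_half i) -addnn addnA leq_addl.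
Qed.

Lemma finite_uniform_bound (n : nat) (P : nat -> nat -> Prop) :
  (forall i M N, M <= N -> P i M -> P i N) ->
  (forall i, i < n -> exists N, P i N) ->
  exists N, forall i, i < n -> P i N.
Proof.
move=> Pmono; elim: n => [|n IHn] Pn; first by exists 0.
have [N PN] := IHn (fun i lt_in => Pn i (ltnW lt_in)).
have [M PM] := Pn n (ltnSn n).
exists (maxn M N) => i; rewrite ltnS leq_eqVlt => /predU1P[->|lt_in].
  by apply: Pmono PM; exact: leq_maxl.
by apply: Pmono (PN i lt_in); exact: leq_maxr.
Qed.

Lemma oeval_inj p n (e : oprog n) v y y' :
  oeval p e v y -> oeval p e v y' -> y = y'.
Proof.
elim: e v y y' => {n} /= [n| |n i| |m n e IHe es IHes|n e0 IH0 eS IHS|n e IHe].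
- by move=> v y y' -> ->.
- by move=> v y y' -> ->.
- by move=> v y y' -> ->.
- by move=> v y y' -> ->.
- move=> v y y' [w ew wy] [w' ew' wy'].
  suff ww' : w = w' by apply: IHe wy _; rewrite ww'.
  by apply: eq_from_tnth => i; exact: IHes (ew i) (ew' i).
- move=> v; elim: (thead v) => [|k IHk] y y'; first exact: IH0.
  by move=> [u ku uy] [u' ku']; rewrite -(IHk _ _ ku ku'); exact: IHS.
- move=> v y y' [y0 lty] [y'0 lty']; have [ltyy'|lty'y|//] := ltngtP y y'.
    by have [u] := lty' _ ltyy'; move/(IHe _ _ _ y0).
  by have [u] := lty _ lty'y; move/(IHe _ _ _ y'0).
Qed.

(** A halting computation queries its oracle only finitely often; by induction on programs, the
    bounds of the subcomputations are combined by maxima. *)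
Lemma oeval_finite_use p n (e : oprog n) v y : oeval p e v y ->
  exists N, forall p', agree N p p' -> oeval p' e v y.
Proof.
elim: e v y => {n} /= [n| |n i| |m n e IHe es IHes|n e0 IH0 eS IHS|n e IHe].
- by move=> v y ->; exists 0.
- by move=> v y ->; exists 0.
- by move=> v y ->; exists 0.
- by move=> v y ->; exists (thead v).+1 => p' pp'; exact: pp'.
- move=> v y [w ew /IHe[M ey]].
  (* [finite_uniform_bound] runs over natural numbers, hence the detour through those [j : 'I_m]
     whose value is [i]. *)
  have [N esN] : exists N, forall i, i < m ->
      forall j : 'I_m, j = i :> nat -> forall p', agree N p p' ->
      oeval p' (es j) v (tnth w j).
    apply: (@finite_uniform_bound m (fun i N => forall j : 'I_m, j = i :> nat ->
      forall p', agree N p p' -> oeval p' (es j) v (tnth w j))).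
      by move=> i L N LN iL j ji p' pp'; apply: iL => //; exact: agree_leq pp'.
    move=> i im; have [N esN] := IHes (Ordinal im) _ _ (ew (Ordinal im)).
    by exists N => j ji; rewrite (_ : j = Ordinal im) //; exact: val_inj.
  exists (maxn M N) => p' pp'; exists w => [i|].
    by apply: (esN i) => //; exact: agree_leq (leq_maxr _ _) pp'.
  by apply: ey; exact: agree_leq (leq_maxl _ _) pp'.
- move=> v; elim: (thead v) => [|k IHk] y; first exact: IH0.
  move=> [u /IHk[M ku] /IHS[N uy]]; exists (maxn M N) => p' pp'; exists u.
    by apply: ku; exact: agree_leq (leq_maxl _ _) pp'.
  by apply: uy; exact: agree_leq (leq_maxr _ _) pp'.
- move=> v y [/IHe[M ey] lty].
  have [N ltN] : exists N, forall z, z < y -> forall p', agree N p p' ->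
      exists u, oeval p' e (cons_tuple z v) u.+1.
    apply: (@finite_uniform_bound y (fun z N => forall p', agree N p p' ->
      exists u, oeval p' e (cons_tuple z v) u.+1)).
      by move=> i L N LN iL p' pp'; apply: iL; exact: agree_leq pp'.
    move=> z /lty[u /IHe[N eN]]; exists N => p' pp'; exists u; exact: eN.
  exists (maxn M N) => p' pp'; split.
    by apply: ey; exact: agree_leq (leq_maxl _ _) pp'.
  by move=> z /ltN; apply; exact: agree_leq (leq_maxr _ _) pp'.
Qed.

Lemma clopen_agree N p : clopen (agree N p).
Proof.
elim: N => [|N IHN].
  by rewrite (_ : agree 0 p = setT) ?predeqE; [exact: clopenT|].
rewrite (_ : agree N.+1 p = agree N p `&` ((fun q : baire => q N) @^-1` [set p N])).
  apply: clopenI => //; apply: preimage_clopen; last exact: (@proj_continuous _ (fun=> nat) N).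
  by split; [exact: discrete_open|exact: discrete_closed].
rewrite predeqE => q; split=> [pq|[pq qN] i].
  by split=> [i iN|]; [apply: pq; exact: ltnW|rewrite /= pq].
by rewrite ltnS leq_eqVlt => /predU1P[->|/pq//]; rewrite -qN.
Qed.

Lemma clopen_subspace_agree (D : set baire) N p :
  clopen ((D `&` agree N p) : set (subspace D)).
Proof.
have [oA cA] := clopen_agree N p; split.
  by rewrite open_subspaceTI; exact: open_subspaceW.
by apply/closed_subspaceP; exists (agree N p) => //; rewrite setIAC setIid setIC.
Qed.

(** The fixed zero tail makes equal answers equal as inputs of [H], not only equal as numbers. *)
Definition nat_name (n : nat) : baire := fun i => if i is 0 then n else 0.

(** The choice depends only on the named point, not on the name. The default [0] is never taken,
    since [f x] is non-empty on [mdom f]. *)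
Lemma canonical_realizer_fun (X : repSpace) (f : mvfun X natRep) p q q' :
  (exists2 x, rep X p x & mdom f x /\ q = nat_name (xget 0 (f x))) ->
  (exists2 x, rep X p x & mdom f x /\ q' = nat_name (xget 0 (f x))) -> q = q'.
Proof. by move=> [x px [_ ->]] [x' px' [_ ->]]; rewrite (pgraph_fun px px'). Qed.

Definition canonical_realizer (X : repSpace) (f : mvfun X natRep) :
  pfun baire baire := PFun (@canonical_realizer_fun X f).

Lemma canonical_realizerP (X : repSpace) (f : mvfun X natRep) :
  realizes (canonical_realizer f) f.
Proof.
move=> p x px dx; exists (nat_name (xget 0 (f x))); split; first by exists x.
by exists (xget 0 (f x)) => //; case: dx => y; exact: xgetI.
Qed.

Lemma canonical_realizer_range (X : repSpace) (f : mvfun X natRep) p q :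
  canonical_realizer f p q -> exists2 n, mrange f n & q = nat_name n.
Proof.
move=> [x px [dx ->]]; exists (xget 0 (f x)) => //; exists x => //.
by case: dx => y; exact: xgetI.
Qed.

Lemma Upart_singleton {X Y : repSpace} (f : mvfun X Y) x y :
  f x = [set y] -> Upart f x = [set y].
Proof.
move=> fx; rewrite /Upart /mrestrict predeqE => z; split=> [[]|->] /=.
  by rewrite fx.
by rewrite fx; split=> //; split; [rewrite /mdom /= fx; exists y|exists y].
Qed.

Lemma Upart_inv {X Y : repSpace} (f : mvfun X Y) x y :
  Upart f x y -> f x = [set y].
Proof. by move=> [[_ [z fx]]]; rewrite fx => ->. Qed.

Lemma slim_Upart_range {X Y : repSpace} (f : mvfun X Y) :
  slim f -> mrange (Upart f) = mrange f.
Proof.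
move=> sf; rewrite predeqE => y; split=> [[x _ /Upart_inv fx]|/sf[x _ fx]].
  by exists x; [exists y|]; rewrite fx.
by exists x; [exists y|]; rewrite (Upart_singleton fx).
Qed.

(** Against the canonical realizer, [H] sees nothing but [nat_name n] with [n] in the range of [g],
    so its first digit is a function of [n]. Where [f] allows only [y] this digit is [y]; by
    slimness the function reaches all of [mrange f]. *)
Lemma strong_weihrauch_le_card (X Z : repSpace)
    (f : mvfun X natRep) (g : mvfun Z natRep) :
  slim f -> strong_weihrauch_le f g -> (mrange f #<= mrange g)%card.
Proof.
move=> sf [H [K [_ _ HK]]].
have HG := HK _ (@canonical_realizerP _ g).
(* The default [0] covers those [n] for which [H] is undefined at [nat_name n]. *)
pose h n := xget 0 [set y | exists2 q, H (nat_name n) q & q 0 = y].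
suff fh : mrange f `<=` h @` mrange g.
  exact: card_le_trans (subset_card_le fh) (card_image_le _ _).
move=> y /sf[x dx fx]; have [p px] := rep_surj x.
have [q [[r [t _ /canonical_realizer_range[n gn ->]] Hq] [z qz fxz]]] :=
  HG p x px dx.
exists n => //; apply: xget_unique => [|y' [q' Hq' <-]].
  by exists q => //; move: fxz; rewrite fx => <-.
by rewrite (pgraph_fun Hq' Hq); move: fxz; rewrite fx => <-.
Qed.

Lemma Upart_slim {X Y : repSpace} (f : mvfun X Y) : slim (Upart f).
Proof.
move=> y [x dx /Upart_inv fx]; exists x => //; exact: Upart_singleton.
Qed.

Theorem theorem13p3 (X Z : repSpace) (f : mvfun X natRep) (g : mvfun Z natRep) :
  slim f -> strong_fractal (Upart f) ->
  weihrauch_le f g -> (mrange f #<= mrange g)%card.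
Proof.
move=> sf ff [H [K [[e eH] _ HK]]]; apply: contrapT => nfg.
have HG := HK _ (@canonical_realizerP _ g).
set D := namedom (Upart f) in ff *.
have [p0 Dp0] : D !=set0.
  apply: contrapT => D0; apply: nfg.
  suff -> : mrange f = set0 by exact: card_ge0.
  rewrite -subset0 => y /sf[x _ fx]; have [p px] := rep_surj x.
  by apply: D0; exists p, x => //; exists y; rewrite (Upart_singleton fx).
(* [s] lists the answers frozen so far and [v n] is the digit forced by the answer [n] near [p]. The
   invariant is about the program [e], because [H] itself may be undefined at nearby pairs. *)
suff IH j : exists s : seq nat, [/\ uniq s, size s = j, [set` s] `<=` mrange g &
    exists v p N, D p /\ forall n p', n \in s -> D p' -> agree N p p' ->
      oeval (baire_pair p' (nat_name n)) e [tuple 0] (v n)].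
  have : infinite_set (mrange g).
    move=> /finite_seqP[t gt]; have [s [us st sg _]] := IH (size t).+1.
    suff: size s <= size t by rewrite st ltnn.
    by apply: uniq_leq_size => // n /sg; rewrite gt.
  by move=> /infiniteP /(card_le_trans (card_leT (mrange f))).
elim: j => [|j [s [us sj sg [v [p [N [Dp vP]]]]]]].
  by exists [::]; split=> //; exists id, p0, 0.
pose A := D `&` agree N p.
have fA : (mrange f #<= mrange (name_restrict (Upart f) A))%card.
  rewrite -(slim_Upart_range sf); apply: strong_weihrauch_le_card => //.
    exact: Upart_slim.
  by apply: ff; [exists p|exact: subIsetl|exact: clopen_subspace_agree].
(* Otherwise [v] maps [s], a part of [mrange g], onto a set containing the range over [A], and [fA]
   contradicts [nfg]. *)
have [y [[[x [p1 [Dp1 pp1] p1x]] _ fxy] ys]] :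
    exists y, mrange (name_restrict (Upart f) A) y /\ ~ (v @` [set` s]) y.
  apply: contrapT => /forallNP nys; apply: nfg; apply: card_le_trans fA _.
  have As : mrange (name_restrict (Upart f) A) `<=` v @` [set` s].
    by move=> y Ay; apply: contrapT => ys; apply: (nys y); split.
  apply: card_le_trans (subset_card_le As) _.
  exact: card_le_trans (card_image_le _ _) (subset_card_le sg).
have fx : f x = [set y] := Upart_inv fxy.
have [|q [[r [_ [t _ /canonical_realizer_range[n gn ->]] ->] Hq]
  [z <- fxz]]] := HG p1 x p1x; first by exists y; rewrite fx.
have {z fxz}en : oeval (baire_pair p1 (nat_name n)) e [tuple 0] y.
  by move: fxz; rewrite fx => <-; exact: eH.
(* An already frozen [n] would yield the digit [v n] at [p1], but [y] lies outside the image of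
   [s]. *)
have ns : n \notin s.
  apply/negP => ns; apply: ys; exists n => //.
  by apply: oeval_inj en; exact: vP.
have [M eM] := oeval_finite_use en.
exists (n :: s); split; [by rewrite /= ns|by rewrite /= sj| |].
  by move=> m; rewrite /= inE => /predU1P[->|/sg].
(* Around the new centre [p1], agreement up to [M] freezes [n] at [y], and agreement up to [N] stays
   inside the old neighbourhood of [p]. *)
exists (fun m => if m == n then y else v m), p1, (maxn M N).
split=> // m p' + Dp' p1p'.
rewrite inE; case: eqVneq => [-> _|_ ms].
  by apply/eM/agree_baire_pair; exact: agree_leq (leq_maxl _ _) p1p'.
apply: vP => // i iN; rewrite pp1//.
by apply: p1p'; exact: leq_trans iN (leq_maxr _ _).
Qed.
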